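(* Let $x,y$ be Hermitian $n\times n$ complex matrices, let $t_0>0$, and let $u(t)=e^{itx}e^{iy}$. Suppose that for all $t\in[0,t_0]$ we have $\|u(t)-1\|<\sqrt{2}$ and that $u(t)$ has distinct eigenvalues $e^{i\theta_k(t)}$, $k=1,\dots,n$, where $\theta_1(t)>\theta_2(t)>\dots>\theta_n(t)$ are the eigenvalues of $-i\log(u(t))$. Then for every $1\le m\le n$ the function $$t\mapsto\sum_{i=1}^m\theta_i(t)$$ is convex in $[0,t_0]$.
   Context: $\|\cdot\|$ denotes the spectral (operator) norm on $M_n(\mathbb C)$. For a unitary matrix $u$ with $\|u-1\|<2$, $\log(u)$ is the principal branch of the logarithm, so $-i\log(u)$ is the unique Hermitian matrix $z$ with $e^{iz}=u$ and $\|z\|<\pi$. *)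

(* Defs.v *)
From HB Require Import structures.
From mathcomp Require Export all_boot all_order all_algebra.
From mathcomp Require Export all_classical all_reals all_analysis.
From mathcomp Require Export complex.

Set Implicit Arguments.
Unset Strict Implicit.
Unset Printing Implicit Defensive.

Export Order.TTheory GRing.Theory Num.Theory.
Export numFieldNormedType.Exports.

Local Open Scope classical_set_scope.
Local Open Scope ring_scope.
Local Open Scope complex_scope.

(* The limit of the partial sums is taken in the entrywise topology of
   matrices over K. *)
Definition expmx (K : numFieldType) (n : nat) (A : 'M[K]_n) : 'M[K]_n :=
  limn (series (fun k : nat => k`!%:R^-1 *: (A ^+ k : 'M[K]_n))).

Definition norm2 (R : realType) (n : nat) (v : 'cV[R[i]]_n) : R :=
  Num.sqrt (\sum_(i < n) ComplexField.Normc.normc (v i 0) ^+ 2).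

Definition opnorm (R : realType) (n : nat) (A : 'M[R[i]]_n) : R :=
  sup [set norm2 (A *m v) | v in [set v : 'cV[R[i]]_n | norm2 v <= 1]].

(* For a unitary u with opnorm (u - 1) < 2 exactly one z satisfies the three
   conditions, and 'i z is the principal logarithm of u. The value is 0 when
   no z satisfies them. *)
Definition logmx (R : realType) (n : nat) (u : 'M[R[i]]_n) : 'M[R[i]]_n :=
  'i *: xget 0 [set z : 'M[R[i]]_n |
    [/\ z \is hermsymmx, expmx ('i *: z) = u & opnorm z < pi]].

Definition cis (R : realType) (a : R) : R[i] := cos a +i* sin a.

(* s lists the eigenvalues of A, with algebraic multiplicity. *)
Definition eigenvalues_of (R : realType) (n : nat) (A : 'M[R[i]]_n)
    (s : 'I_n -> R[i]) : Prop :=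
  char_poly A = \prod_(k < n) ('X - (s k)%:P).

(* Main.v *)
Require Import Defs.
From mathcomp Require Import fingroup perm ring lra.

(* Write u(t + s) = F u(t) with F = exp(isx), and let X be the isometry onto the
   span of the top m eigenvectors of u(t), so u(t) X = X D with
   det D = e^{i f(t)}, f(t) being the sum of the top m angles.  The compressions
   X^* F u(t) X = N D and X^* F^* u(t) X = N^* D have determinants
   det(N) e^{i f(t)} and conj(det N) e^{i f(t)}, so the sums of their phases add
   up to 2 f(t) when s is small.  A matrix with positive definite real part is
   congruent to diag(1 + i a_k); the phases are the atan a_k, and they obey
   Cauchy interlacing under compression, so these two sums are at most f(t + s)
   and f(t - s).  Hence 2 f(t) <= f(t + s) + f(t - s) for small s, and f is
   continuous; local midpoint convexity then gives convexity. *)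

Set Implicit Arguments.
Unset Strict Implicit.
Unset Printing Implicit Defensive.

Local Open Scope classical_set_scope.
Local Open Scope ring_scope.
Local Open Scope complex_scope.

(** * Local midpoint convexity *)

Section Convexity.
Variable R : realType.

Lemma within_continuous_eps_delta (a b : R) (f : R -> R) :
  (forall t, a <= t <= b -> forall eta, 0 < eta -> exists2 delta, 0 < delta &
    forall t', a <= t' <= b -> `|t' - t| < delta -> `|f t' - f t| <= eta) ->
  {within `[a, b], continuous f}.
Proof.
move=> fc; apply/subspace_continuousP => t; rewrite /= in_itv /= => tab.
apply/cvgrPdist_le => eta eta0.
have [delta d0 hd] := fc t tab eta eta0.
rewrite near_withinE; near=> t'; rewrite /= in_itv /= => t'ab.
rewrite distrC; apply: hd => //; rewrite distrC.
Unshelve. all: by end_near. Qed.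

(** If [f z] lay above the chord, then [f] minus the chord minus a small multiple of (t - x)(y - t)
    would vanish at both ends and be positive at [z], hence have an interior maximum [c].
    Subtracting a strictly concave parabola makes its second difference at [c] positive for small
    steps, which contradicts maximality. *)
Lemma midpoint_convex_below_chord (x y z : R) (f : R -> R) :
  {within `[x, y], continuous f} -> x < z < y ->
  (forall t, x < t < y -> exists2 e, 0 < e &
     forall s, 0 < s < e -> 2 * f t <= f (t - s) + f (t + s)) ->
  (y - x) * f z <= (y - z) * f x + (z - x) * f y.
Proof.
move=> cf /andP[xz zy] mid; rewrite leNgt; apply/negP => gap.
have xy : 0 < y - x by lra.
pose k := (f y - f x) / (y - x).
have kE : k * (y - x) = f y - f x by rewrite /k divfK // gt_eqF.
pose d := f z - f x - k * (z - x).
have d0 : 0 < d.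
  have dE : d * (y - x) = (f z - f x) * (y - x) - (f y - f x) * (z - x).
    by rewrite -kE /d; ring.
  rewrite -(pmulr_lgt0 _ xy) dE; lra.
have p0 : 0 < (z - x) * (y - z) by apply: mulr_gt0; lra.
(* With this factor the parabola equals [d / 2] at [z], so half of the gap [d] survives in [G z]. *)
pose eps := d / (2 * ((z - x) * (y - z))).
have eps0 : 0 < eps by apply: divr_gt0 => //; apply: mulr_gt0.
have epsE : eps * ((z - x) * (y - z)) = d / 2.
  by rewrite /eps invfM [d * _]mulrA divfK // gt_eqF.
pose G t := f t - f x - k * (t - x) - eps * ((t - x) * (y - t)).
have cG : {within `[x, y], continuous G}.
  move=> t; apply: cvgB; last first.
    apply: (@continuous_subspaceT R R `[x, y]
      (fun t => eps * ((t - x) * (y - t)))).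
    move=> u; apply: cvgM; first exact: cvg_cst.
    apply: cvgM; first by apply: cvgB; [exact: cvg_id|exact: cvg_cst].
    by apply: cvgB; [exact: cvg_cst|exact: cvg_id].
  apply: cvgB; last first.
    apply: (@continuous_subspaceT R R `[x, y] (fun t => k * (t - x))).
    move=> u; apply: cvgM; first exact: cvg_cst.
    by apply: cvgB; [exact: cvg_id|exact: cvg_cst].
  by apply: cvgB; [exact: cf|exact: cvg_cst].
have [c /[!in_itv]/=/andP[xc cy] cmax] := EVT_max (ltW (lt_trans xz zy)) cG.
have Gz : 0 < G z.
  have := cmax z; rewrite /G epsE -/d; lra.
have Gc : 0 < G c.
  by apply: lt_le_trans Gz (cmax z _); rewrite in_itv /= !ltW.
have cx : x < c.
  rewrite lt_neqAle xc andbT; apply/eqP => E; move: Gc.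
  by rewrite /G -E !subrr mulr0 mul0r mulr0 !subr0 ltxx.
have yc : c < y.
  rewrite lt_neqAle cy andbT; apply/eqP => E; move: Gc.
  by rewrite /G E kE !subrr mulr0 mulr0 subr0 ltxx.
have [|e e0 he] := mid c; first by rewrite cx yc.
(* Halving [e] gives the strict bound required by [he]; the other two terms keep [c - s] and [c + s]
   inside the interval. *)
pose s := Num.min (e / 2) (Num.min (c - x) (y - c)).
have s0 : 0 < s by rewrite !lt_min divr_gt0 //= !subr_gt0 cx.
have se : s < e by rewrite gt_min; apply/orP; left; lra.
have sx : s <= c - x by rewrite !ge_min lexx orbT.
have sy : s <= y - c by rewrite !ge_min lexx !orbT.
have hs := he s; rewrite s0 se in hs; have {}hs := hs isT.
have m1 := cmax (c - s); rewrite in_itv /= in m1.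
have m2 := cmax (c + s); rewrite in_itv /= in m2.
have {}m1 : G (c - s) <= G c by apply: m1; lra.
have {}m2 : G (c + s) <= G c by apply: m2; lra.
have : G (c - s) + G (c + s) - 2 * G c =
    f (c - s) + f (c + s) - 2 * f c + 2 * (eps * s ^+ 2) by rewrite /G; ring.
have : 0 < eps * s ^+ 2 by rewrite mulr_gt0 // exprn_gt0.
lra.
Qed.

(** The midpoint inequality is assumed only at interior points and for small steps; continuity up to
    the endpoints carries the chord inequality to the closed interval. *)
Lemma convex_function_midpoint (t0 : R) (f : R -> R) :
  (forall t, 0 <= t <= t0 -> forall eta, 0 < eta -> exists2 delta, 0 < delta &
    forall t', 0 <= t' <= t0 -> `|t' - t| < delta -> `|f t' - f t| <= eta) ->
  (forall t, 0 < t < t0 -> exists2 e, 0 < e &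
     forall s, 0 < s < e -> 2 * f t <= f (t - s) + f (t + s)) ->
  convex_function (`[0, t0] : set R^o) (f : R^o -> R^o).
Proof.
move=> fc mid.
have chord x y l : 0 <= x -> x < y -> y <= t0 -> 0 <= l <= 1 ->
    f (l * x + (1 - l) * y) <= l * f x + (1 - l) * f y.
  move=> x0 xy yt /andP[]; rewrite le_eqVlt => /orP[/eqP <- _|l0].
    by rewrite !mul0r !add0r subr0 !mul1r.
  rewrite le_eqVlt => /orP[/eqP ->|l1].
    by rewrite subrr !mul0r !addr0 !mul1r.
  have xy0 : 0 < y - x by lra.
  have z0 : 0 < (1 - l) * (y - x) by apply: mulr_gt0; lra.
  have z1 : 0 < l * (y - x) by apply: mulr_gt0; lra.
  pose z := l * x + (1 - l) * y.
  have cz : {within `[x, y], continuous f}.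
    apply: within_continuous_eps_delta => t tI eta eta0.
    have [|delta d0 hd] := fc t _ eta eta0; first by lra.
    by exists delta => // t' t'I; apply: hd; lra.
  have := @midpoint_convex_below_chord x y z f cz.
  have zI : x < z < y by rewrite /z; lra.
  move=> /(_ zI) H; rewrite -(ler_pM2l xy0); apply: le_trans (H _) _.
    by move=> t tI; apply: mid; lra.
  rewrite le_eqVlt; apply/orP; left; apply/eqP; rewrite /z; ring.
move=> l x y; rewrite !in_setE /= !in_itv /= => /andP[x0 xt] /andP[y0 yt].
have l1 : 0 <= l%:num <= 1 by apply/andP; split.
change (f (l%:num * x + (1 - l%:num) * y) <= l%:num * f x + (1 - l%:num) * f y).
have [xy|yx|->] := ltgtP x y; first by apply: chord.
  rewrite addrC [leRHS]addrC -{2 4}[l%:num](subKr 1); apply: chord => //; lra.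
by rewrite -!mulrDl addrC subrK !mul1r.
Qed.

End Convexity.

(* R[i] inherits its topology from the numFieldType structure only. *)
Definition complex_numField (R : realType) : numFieldType := R[i].

Section TanPhases.
Local Open Scope sesquilinear_scope.
Variable R : realType.
Local Notation C := R[i].
Local Notation K := (complex_numField R).
Local Notation normc := ComplexField.Normc.normc.
Implicit Types (m n : nat).

(** * Quadratic forms and phases *)

Definition sqnorm n (v : 'cV[C]_n) : R :=
  \sum_k normc (v k 0) ^+ 2.

Definition qform n (A : 'M[C]_n) (v : 'cV[C]_n) : C := (v^t* *m A *m v) 0 0.

Lemma sqr_normcE (z : C) :
  normc z ^+ 2 = complex.Re z ^+ 2 + complex.Im z ^+ 2.
Proof. by case: z => a b /=; rewrite sqr_sqrtr // addr_ge0 ?sqr_ge0. Qed.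

Lemma mulJc (z : C) : z^* * z = (normc z ^+ 2)%:C.
Proof.
rewrite sqr_normcE; case: z => a b /=; rewrite -complexr0.
by simpc; congr (_ +i* _); ring.
Qed.

Lemma conjCc (z : C) : Num.conj z = conjc z.
Proof. by []. Qed.

Lemma conjC_real (r : R) : Num.conj (r%:C : C) = r%:C.
Proof. exact: conjc_real. Qed.

Lemma sqnorm_ge0 n (v : 'cV[C]_n) : 0 <= sqnorm v.
Proof. by apply: sumr_ge0 => k _; rewrite sqr_ge0. Qed.

Lemma sqnorm_eq0 n (v : 'cV[C]_n) : (sqnorm v == 0) = (v == 0).
Proof.
apply/idP/eqP => [|->]; last first.
  rewrite /sqnorm big1 // => k _.
  by rewrite mxE ComplexField.Normc.normc0 expr0n.
rewrite psumr_eq0 => [/allP v0|k _]; last by rewrite sqr_ge0.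
apply/matrixP => i j; rewrite ord1 !mxE.
have := v0 i (mem_index_enum _); rewrite sqrf_eq0 => /eqP.
exact: ComplexField.Normc.eq0_normc.
Qed.

Lemma sqnorm_gt0 n (v : 'cV[C]_n) : (0 < sqnorm v) = (v != 0).
Proof. by rewrite lt_def sqnorm_ge0 andbT sqnorm_eq0. Qed.

Lemma qformB n (A B : 'M[C]_n) v : qform (A - B) v = qform A v - qform B v.
Proof. by rewrite /qform mulmxBr mulmxBl !mxE. Qed.

Lemma qformD n (A B : 'M[C]_n) v : qform (A + B) v = qform A v + qform B v.
Proof. by rewrite /qform mulmxDr mulmxDl !mxE. Qed.

Lemma qformZ n c (A : 'M[C]_n) v : qform (c *: A) v = c * qform A v.
Proof. by rewrite /qform -scalemxAr -scalemxAl mxE. Qed.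

Lemma qform_comp m n (A : 'M[C]_n) (X : 'M[C]_(n, m)) v :
  qform (X^t* *m A *m X) v = qform A (X *m v).
Proof. by rewrite /qform trmx_mul map_mxM !mulmxA. Qed.

Lemma qform_diag n (d : 'rV[C]_n) v :
  qform (diag_mx d) v =
    \sum_k (normc (v k 0) ^+ 2)%:C * d 0 k.
Proof.
rewrite /qform mxE; apply: eq_bigr => k _.
by rewrite mul_mx_diag !mxE mulrAC -mulJc.
Qed.

Lemma ReM_real (r : R) (z : C) : complex.Re (r%:C * z) = r * complex.Re z.
Proof. by case: z => a b /=; rewrite mul0r subr0. Qed.

Lemma ImM_real (r : R) (z : C) : complex.Im (r%:C * z) = r * complex.Im z.
Proof. by case: z => a b /=; rewrite mul0r addr0. Qed.

Lemma Re_sum (I : finType) (F : I -> C) :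
  complex.Re (\sum_i F i) = \sum_i complex.Re (F i).
Proof. by apply: (big_morph (@complex.Re R)) => [[a b] [c d]|]. Qed.

Lemma Im_sum (I : finType) (F : I -> C) :
  complex.Im (\sum_i F i) = \sum_i complex.Im (F i).
Proof. by apply: (big_morph (@complex.Im R)) => [[a b] [c d]|]. Qed.

(** The phases of [A] are the angles [atan (a k)]. Recording their tangents normalises the diagonal
    to real part 1: with w = Z v, the real part of the form is the sum of |w_k|^2 and the imaginary
    part is the sum of |w_k|^2 a_k. So Im / Re is a weighted mean of the [a k], which makes min-max
    arguments available. *)
Definition tan_phases n (A : 'M[C]_n) (a : 'I_n -> R) : Prop :=
  (exists2 Z : 'M[C]_n, Z \in unitmx &
     A = Z^t* *m diag_mx (\row_k (1 +i* a k)) *m Z) /\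
  (forall j k : 'I_n, (j <= k)%N -> a k <= a j).

Lemma Re_qform_phases n (Z : 'M[C]_n) a v :
  complex.Re (qform (Z^t* *m diag_mx (\row_k (1 +i* a k)) *m Z) v) =
  sqnorm (Z *m v).
Proof.
rewrite qform_comp qform_diag Re_sum; apply: eq_bigr => k _.
by rewrite ReM_real !mxE /= mulr1.
Qed.

Lemma Im_qform_phases n (Z : 'M[C]_n) a v :
  complex.Im (qform (Z^t* *m diag_mx (\row_k (1 +i* a k)) *m Z) v) =
  \sum_k normc ((Z *m v) k 0) ^+ 2 * a k.
Proof.
rewrite qform_comp qform_diag Im_sum; apply: eq_bigr => k _.
by rewrite ImM_real !mxE.
Qed.

Lemma unitmx_mulv_neq0 n (Z : 'M[C]_n) (v : 'cV_n) :
  Z \in unitmx -> v != 0 -> Z *m v != 0.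
Proof.
move=> Zu; apply: contra => /eqP Zv; apply/eqP.
by rewrite -[v](mulKmx Zu) Zv mulmx0.
Qed.

Lemma tan_phases_Re_gt0 n (A : 'M[C]_n) a v :
  tan_phases A a -> v != 0 -> 0 < complex.Re (qform A v).
Proof.
move=> [[Z Zu ->] _] v0.
by rewrite Re_qform_phases sqnorm_gt0 unitmx_mulv_neq0.
Qed.

(* The square matrix stacking m - 1 linear conditions on v over a zero row is
   singular; this replaces the usual dimension count for the span of the first
   j + 1 and the span of the last n - j eigenvectors. *)
Lemma tan_phases_common_vector m n (lemn : (m <= n)%N)
    (A : 'M[C]_n) (B : 'M[C]_m) a b (X : 'M[C]_(n, m)) (j : 'I_m) :
  tan_phases A a -> tan_phases B b ->
  exists v, [/\ v != 0,
    b j * complex.Re (qform B v) <= complex.Im (qform B v) &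
    complex.Im (qform A (X *m v)) <=
      a (widen_ord lemn j) * complex.Re (qform A (X *m v))].
Proof.
move=> [[Z Zu ->] ha] [[W Wu ->] hb].
pose M : 'M[C]_m := \matrix_(k, l)
  if (k < j)%N then (Z *m X) (widen_ord lemn k) l
  else if k == j then 0 else W k l.
have : \det M^T == 0.
  rewrite det_tr (expand_det_row _ j) big1 // => l _.
  by rewrite !mxE ltnn eqxx mul0r.
move=> /det0P[w w0 wM].
have Mw : M *m w^T = 0 by rewrite -[M]trmxK -trmx_mul wM trmx0.
have lowW (k : 'I_m) : (j < k)%N -> (W *m w^T) k 0 = 0.
  move=> jk; transitivity ((M *m w^T) k 0); last by rewrite Mw mxE.
  rewrite !mxE; apply: eq_bigr => l _; rewrite !mxE ltnNge ltnW //=.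
  by case: eqP jk => // ->; rewrite ltnn.
have topZ (k : 'I_n) : (k < j)%N -> (Z *m (X *m w^T)) k 0 = 0.
  move=> kj; have km : (k < m)%N by apply: ltn_trans kj _.
  transitivity ((M *m w^T) (Ordinal km) 0); last by rewrite Mw mxE.
  rewrite mulmxA !mxE; apply: eq_bigr => l _; rewrite !mxE /= kj.
  by congr (_ * _); apply: eq_bigr => i _; congr (Z _ _ * _); apply: val_inj.
exists w^T; split.
- by apply: contra w0 => /eqP/(congr1 trmx); rewrite trmxK trmx0 => ->.
- rewrite Re_qform_phases Im_qform_phases mulr_sumr; apply: ler_sum => k _.
  case: (leqP k j) => [kj|jk].
    by rewrite mulrC ler_wpM2l ?sqr_ge0 // hb.
  by rewrite lowW // ComplexField.Normc.normc0 expr0n /= mulr0 mul0r.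
- rewrite Re_qform_phases Im_qform_phases mulr_sumr; apply: ler_sum => k _.
  case: (leqP j k) => [jk|kj].
    by rewrite [leRHS]mulrC ler_wpM2l ?sqr_ge0 // ha.
  by rewrite topZ // ComplexField.Normc.normc0 expr0n /= mulr0 mul0r.
Qed.

(** This is the upper half of Cauchy interlacing. The form of the compression at [v] is the form of
    [A] at [X *m v], so the common vector squeezes one ratio Im / Re between [b j] and the [j]-th
    entry of [a]. *)
Lemma tan_phases_compression m n (lemn : (m <= n)%N)
    (A : 'M[C]_n) (X : 'M[C]_(n, m)) a b (j : 'I_m) :
  tan_phases A a -> tan_phases (X^t* *m A *m X) b ->
  b j <= a (widen_ord lemn j).
Proof.
move=> hA hB.
have [v [v0 hb ha]] := tan_phases_common_vector lemn X j hA hB.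
have := tan_phases_Re_gt0 hB v0.
rewrite qform_comp in hb * => Re_gt0.
by rewrite -(ler_pM2r Re_gt0); apply: le_trans hb ha.
Qed.

(** If b_j > c = a_j + delta, the common vector for X = 1 has Im q_B >= c Re q_B and Im q_A <= (c -
    delta) Re q_A. Hence Im - c Re of the difference q_B - q_A is at least delta Re q_A, too much
    for forms that close. The case b_j < a_j - delta exchanges [A] and [B]. *)
Lemma tan_phases_perturbation n (A B : 'M[C]_n) a b (j : 'I_n)
    (eps kappa delta : R) :
  tan_phases A a -> tan_phases B b -> 0 <= delta ->
  (forall v, `|complex.Re (qform B v - qform A v)| <= eps * sqnorm v) ->
  (forall v, `|complex.Im (qform B v - qform A v)| <= eps * sqnorm v) ->
  (forall v, kappa * sqnorm v <= complex.Re (qform A v)) ->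
  eps * (1 + `|a j| + delta) < delta * kappa ->
  `|b j - a j| <= delta.
Proof.
move=> hA hB d0 hRe hIm hk small.
have widj : widen_ord (leqnn n) j = j by apply: val_inj.
have ReB z w : complex.Re (z - w) = complex.Re z - complex.Re w :> R.
  by case: z => ? ?; case: w => ? ?.
have ImB z w : complex.Im (z - w) = complex.Im z - complex.Im w :> R.
  by case: z => ? ?; case: w => ? ?.
(* The bound on [c] covers both [a j + delta] and [a j - delta]; the factor [1 + |a j| + delta] of
   the smallness hypothesis is the resulting bound on 1 + |c|. *)
have key c v : v != 0 -> `|c| <= `|a j| + delta ->
    `|complex.Im (qform B v - qform A v) -
        c * complex.Re (qform B v - qform A v)| <
      delta * complex.Re (qform A v).
  move=> v0 hc; apply: le_lt_trans (ler_normB _ _) _; rewrite normrM.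
  have s0 : 0 < sqnorm v by rewrite sqnorm_gt0.
  have step : delta * (kappa * sqnorm v) <= delta * complex.Re (qform A v).
    exact: ler_wpM2l.
  apply: lt_le_trans step.
  apply: (@le_lt_trans _ _
      (eps * sqnorm v + (`|a j| + delta) * (eps * sqnorm v))).
    by apply: lerD => //; apply: ler_pM.
  rewrite mulrA.
  rewrite [ltLHS](_ : _ = (eps * (1 + `|a j| + delta)) * sqnorm v);
    last by ring.
  by rewrite ltr_pM2r.
rewrite leNgt; apply/negP; rewrite ltr_normr => /orP[] gt.
- have [v [v0]] := tan_phases_common_vector (leqnn n) 1%:M j hA hB.
  rewrite widj mul1mx => hb ha.
  have hBv := tan_phases_Re_gt0 hB v0.
  have cb : `|a j + delta| <= `|a j| + delta.
    by rewrite -{2}(ger0_norm d0) ler_normD.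
  have := key _ v v0 cb; rewrite ReB ImB => /(le_lt_trans (ler_norm _)).
  have : (a j + delta) * complex.Re (qform B v) <= b j * complex.Re (qform B v).
    by rewrite ler_pM2r //; lra.
  lra.
- have [v [v0]] := tan_phases_common_vector (leqnn n) 1%:M j hB hA.
  rewrite widj mul1mx => ha hb.
  have hBv := tan_phases_Re_gt0 hB v0.
  have cb : `|a j - delta| <= `|a j| + delta.
    by rewrite -{2}(ger0_norm d0) ler_normB.
  have := key _ v v0 cb; rewrite ReB ImB.
  rewrite -normrN => /(le_lt_trans (ler_norm _)).
  have : b j * complex.Re (qform B v) <= (a j - delta) * complex.Re (qform B v).
    by rewrite ler_pM2r //; lra.
  lra.
Qed.

(** * Existence of phases *)

Lemma hermsymmxP n (A : 'M[C]_n) : reflect (A^t* = A) (A \is hermsymmx).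
Proof.
apply: (iffP (is_hermitianmxP _ _ _)); rewrite expr0 scale1r //.
Qed.

Lemma eq_congr_diag n (Z : 'M[C]_n) (d e : 'rV[C]_n) :
  (forall k, d 0 k = e 0 k) ->
  Z^t* *m diag_mx d *m Z = Z^t* *m diag_mx e *m Z.
Proof. by move=> de; have -> : d = e by apply/rowP. Qed.

Lemma herm_spectral n (A : 'M[C]_n) : A \is hermsymmx ->
  exists P (d : 'I_n -> R),
    P \is unitarymx /\ A = P^t* *m diag_mx (\row_k (d k)%:C) *m P.
Proof.
move=> hA; exists (spectralmx A), (fun k => complex.Re (spectral_diag A 0 k)).
have /orthomx_spectralP AE := hermitian_normalmx hA.
split; first exact: spectral_unitarymx.
rewrite {1}AE (invmx_unitary (spectral_unitarymx A)).
apply: eq_congr_diag => k; rewrite mxE RRe_real //.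
by have /mxOverP := hermitian_spectral_diag_real hA.
Qed.

Lemma congr_diagE n (Z : 'M[C]_n) (d : 'rV[C]_n) i j :
  (Z^t* *m diag_mx d *m Z) i j = \sum_k (Z k i)^* * d 0 k * Z k j.
Proof.
rewrite mxE; apply: eq_bigr => k _.
by rewrite mul_mx_diag !mxE.
Qed.

Lemma congr_diag_perm n (s : 'S_n) (Z : 'M[C]_n) (d : 'I_n -> C) :
  (row_perm s Z)^t* *m diag_mx (\row_k d (s k)) *m row_perm s Z =
  Z^t* *m diag_mx (\row_k d k) *m Z.
Proof.
apply/matrixP => i j; rewrite !congr_diagE [RHS](reindex_inj (@perm_inj _ s)).
by apply: eq_bigr => k _; rewrite !mxE.
Qed.

Lemma row_perm_unitmx n (s : 'S_n) (Z : 'M[C]_n) :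
  Z \in unitmx -> row_perm s Z \in unitmx.
Proof. by move=> Zu; rewrite row_permE unitmx_mul unitmx_perm. Qed.

Lemma row_perm_unitary n (s : 'S_n) (Z : 'M[C]_n) :
  Z \is unitarymx -> row_perm s Z \is unitarymx.
Proof.
move=> Zu; rewrite row_permE; apply: mul_unitarymx; last exact: Zu.
apply/unitarymxP; rewrite tr_perm_mx map_perm_mx -perm_mxM.
by rewrite mulgV perm_mx1.
Qed.

Lemma sorting_perm n (a : 'I_n -> R) :
  exists s : 'S_n, forall j k : 'I_n, (j <= k)%N -> a (s k) <= a (s j).
Proof.
pose t := [tuple a i | i < n].
have /tuple_permP[s sE] : perm_eq (sort_tuple >=%O t) t by rewrite perm_sort.
exists s => j k jk.
have nthE (i : 'I_n) : a (s i) = nth 0 (sort >=%O t) i.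
  by rewrite sE -tnth_nth tnth_mktuple tnth_mktuple.
rewrite !nthE; apply: (@sorted_leq_nth _ >=%O).
- by move=> y x z /= xy yz; apply: le_trans yz xy.
- by move=> x /=.
- by apply: sort_sorted => x y /=; apply: le_total.
- by rewrite inE size_sort size_tuple.
- by rewrite inE size_sort size_tuple.
- by [].
Qed.

(** The positive factors [r k] are absorbed into the congruence by scaling the rows of [P] by their
    square roots. *)
Lemma tan_phases_scaled n (A P : 'M[C]_n) (r a : 'I_n -> R) :
  P \in unitmx -> (forall k, 0 < r k) ->
  A = P^t* *m diag_mx (\row_k ((r k)%:C * (1 +i* a k))) *m P ->
  (forall j k : 'I_n, (j <= k)%N -> a k <= a j) ->
  tan_phases A a.
Proof.
move=> Pu r0 AE ha; split=> //.
pose D : 'M[C]_n := diag_mx (\row_k (Num.sqrt (r k))%:C).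
exists (D *m P).
  rewrite unitmx_mul Pu andbT unitmxE det_diag unitfE.
  apply/prodf_neq0 => k _; rewrite mxE -complexr0 eq_complex /= negb_and.
  by rewrite gt_eqF // sqrtr_gt0.
apply/matrixP => i j; rewrite AE !congr_diagE; apply: eq_bigr => k _.
rewrite mul_diag_mx !mxE rmorphM /=.
rewrite conjC_real.
rewrite -{1}(@sqr_sqrtr _ (r k)) ?ltW // rmorphXn /=.
by ring.
Qed.

(** Simultaneous diagonalisation: write A = H + iK with [H], [K] Hermitian. [H] is positive
    definite, so H = G^* G with [G] invertible. A unitary [Q] diagonalising the Hermitian matrix
    that represents [K] in the coordinates of [G] leaves H the identity there, and [Q *m G], with
    rows sorted, is the congruence. *)
Lemma tan_phases_exists n (A : 'M[C]_n) :
  (forall v, v != 0 -> 0 < complex.Re (qform A v)) -> exists a, tan_phases A a.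
Proof.
move=> posA.
have trCK m p (B : 'M[C]_(m, p)) : ((B ^t*) ^t* = B) by exact: trmxCK.
have trCM m p q (B : 'M[C]_(m, p)) (B' : 'M[C]_(p, q)) :
  (B *m B')^t* = B'^t* *m B^t* by rewrite trmx_mul map_mxM.
have trCD m p (B B' : 'M[C]_(m, p)) : (B + B')^t* = B^t* + B'^t*.
  by apply/matrixP => i j; rewrite !mxE rmorphD.
have trCZ m p c (B : 'M[C]_(m, p)) : (c *: B)^t* = Num.conj c *: B^t*.
  by apply/matrixP => i j; rewrite !mxE rmorphM.
pose H : 'M[C]_n := 2^-1 *: (A + A^t*).
pose K : 'M[C]_n := (- 'i / 2) *: (A + (-1) *: A^t*).
have half : Num.conj (2^-1 : C) = 2^-1 by rewrite fmorphV rmorph_nat.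
have hH : H \is hermsymmx.
  by apply/hermsymmxP; rewrite /H trCZ trCD trCK half addrC.
have hK : K \is hermsymmx.
  apply/hermsymmxP; rewrite /K trCZ trCD trCZ trCK.
  rewrite !scalerDr !scalerA addrC rmorphM /= half.
  by congr (_ *: _ + _ *: _); rewrite conjCc; apply/eqP;
     rewrite eq_complex /=; simpc.
have i2 : 'i * 'i = -1 :> C by rewrite -expr2 sqr_i.
have AE : A = H + 'i *: K.
  rewrite /H /K !scalerDr !scalerA; apply/matrixP => i j; rewrite !mxE.
  by rewrite !mulrA mulrN i2; field.
clearbody H K.
have [P [h [Pu HE]]] := herm_spectral hH.
have [S [c [_ KE]]] := herm_spectral hK.
have KR v : complex.Im (qform K v) = 0.
  rewrite KE qform_comp qform_diag Im_sum big1 // => k _.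
  by rewrite ImM_real !mxE /= mulr0.
have Pu' := unitarymx_unit Pu.
(* Each eigenvalue of [H] is the real part of the form of [A] at an eigenvector of [H], because the
   form of [K] is real and enters with the factor i. *)
have h0 k : 0 < h k.
  have e0 : P^t* *m delta_mx k 0 != 0 :> 'cV[C]_n.
    apply: unitmx_mulv_neq0; first by rewrite unitarymx_unit ?trmxC_unitary.
    by apply/eqP => /matrixP/(_ k 0)/eqP; rewrite !mxE !eqxx oner_eq0.
  suff -> : h k = complex.Re (qform A (P^t* *m delta_mx k 0)) by exact: posA.
  have -> : qform A (P^t* *m delta_mx k 0) = qform H (P^t* *m delta_mx k 0)
      + 'i * qform K (P^t* *m delta_mx k 0).
    by rewrite [in LHS]AE qformD qformZ.
  have := KR (P^t* *m delta_mx k 0).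
  case: (qform K _) => p q /= ->.
  have -> : qform H (P^t* *m delta_mx k 0) = (h k)%:C.
    rewrite HE qform_comp mulmxA (unitarymxP Pu) mul1mx qform_diag.
    rewrite (bigD1 k) //= big1 ?addr0 => [|l lk].
      by rewrite !mxE !eqxx ComplexField.Normc.normc1 expr1n mul1r.
    by rewrite !mxE (negPf lk) ComplexField.Normc.normc0 expr0n mul0r.
  by rewrite /=; simpc.
pose D : 'M[C]_n := diag_mx (\row_k (Num.sqrt (h k))%:C).
pose G := D *m P.
have Gu : G \in unitmx.
  rewrite unitmx_mul Pu' andbT unitmxE det_diag unitfE.
  apply/prodf_neq0 => k _; rewrite mxE -complexr0 eq_complex /= negb_and.
  by rewrite gt_eqF // sqrtr_gt0.
have HG : H = G^t* *m G.
  rewrite HE /G trCM -!mulmxA; congr (_ *m _).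
  rewrite !mulmxA; congr (_ *m _).
  apply/matrixP => i j; rewrite mul_mx_diag !mxE.
  case: (eqVneq i j) => [->|ij]; last by rewrite !mulr0n ?conjC0 mul0r.
  rewrite !mulr1n conjC_real -rmorphM /= -expr2 sqr_sqrtr //.
  exact: ltW.
clearbody G.
pose M : 'M[C]_n := (invmx G)^t* *m K *m invmx G.
have hM : M \is hermsymmx.
  by apply/hermsymmxP; rewrite /M !trCM trCK (hermsymmxP _ hK) mulmxA.
have KG : K = G^t* *m M *m G.
  rewrite /M !mulmxA -(trCM _ _ _ (invmx G) G) (mulVmx Gu) trmx1 map_mx1 mul1mx.
  by rewrite (mulmxKV Gu).
clearbody M.
have [Q [mu [Qu ME]]] := herm_spectral hM.
have [s sP] := sorting_perm mu.
exists (fun k => mu (s k)).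
apply: (@tan_phases_scaled _ _ (row_perm s (Q *m G)) (fun=> 1)) => //.
  by rewrite row_perm_unitmx // unitmx_mul Gu unitarymx_unit.
rewrite (congr_diag_perm s (Q *m G) (fun k => 1%:C * (1 +i* mu k))).
have -> : diag_mx (\row_k (1%:C * (1 +i* mu k))) =
    1%:M + 'i *: diag_mx (\row_k (mu k)%:C) :> 'M[C]_n.
  apply/matrixP => i j; rewrite !mxE.
  case: (eqVneq i j) => [->|ij]; last by rewrite !mulr0n mulr0 addr0.
  by rewrite !mulr1n; apply/eqP; rewrite eq_complex /=; simpc.
rewrite trCM mulmxDr mulmxDl -scalemxAr -scalemxAl mulmx1.
have -> : G^t* *m Q^t* *m (Q *m G) = H.
  rewrite mulmxA -[G^t* *m _ *m Q]mulmxA.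
  have /unitarymxP := Qu => /mulmx1C ->; by rewrite mulmx1 HG.
have -> : G^t* *m Q^t* *m diag_mx (\row_k (mu k)%:C) *m (Q *m G) = K.
  by rewrite KG ME !mulmxA.
exact: AE.
Qed.

(** * Polar form and determinants *)

Lemma cisD (b c : R) : cis (b + c) = cis b * cis c :> C.
Proof. by rewrite /cis cosD sinD; simpc; congr (_ +i* _); ring. Qed.

Lemma cis0 : cis 0 = 1 :> C.
Proof. by rewrite /cis cos0 sin0. Qed.

Lemma cis_sum (I : finType) (F : I -> R) :
  cis (\sum_i F i) = \prod_i cis (F i) :> C.
Proof. exact: (big_morph _ cisD cis0). Qed.

Lemma cis_atan (a : R) : 1 +i* a = ((cos (atan a))^-1)%:C * cis (atan a).
Proof.
have c0 : cos (atan a) != 0.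
  by rewrite cos_atan invr_neq0 // gt_eqF // sqrtr_gt0 ltr_pwDl // sqr_ge0.
have ta := atanK a; rewrite /tan in ta.
by rewrite /cis; simpc; rewrite mulVf // mulrC ta.
Qed.

Lemma cos_atan_gt0 (a : R) : 0 < cos (atan a).
Proof. by rewrite cos_atan invr_gt0 sqrtr_gt0 ltr_pwDl // sqr_ge0. Qed.

(** A congruence by [Z] multiplies the determinant by |det Z|^2, and each 1 + i a_k is a positive
    multiple of [cis (atan (a k))], so the sum of the phases is an argument of the determinant. *)
Lemma tan_phases_det n (A : 'M[C]_n) a : tan_phases A a ->
  exists2 r : R, 0 < r & \det A = r%:C * cis (\sum_k atan (a k)).
Proof.
move=> [[Z Zu ->] _].
exists (normc (\det Z) ^+ 2 * \prod_k (cos (atan (a k)))^-1).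
  apply: mulr_gt0; last first.
    by apply: prodr_gt0 => k _; rewrite invr_gt0 cos_atan_gt0.
  rewrite exprn_even_gt0 //=; apply/eqP => /ComplexField.Normc.eq0_normc.
  by apply/eqP; rewrite -unitfE -unitmxE.
rewrite !det_mulmx det_diag det_map_mx det_tr rmorphM /= -mulJc.
rewrite mulrAC -!mulrA; congr (_ * (_ * _)).
rewrite rmorph_prod cis_sum -big_split; apply: eq_bigr => k _.
by rewrite mxE cis_atan.
Qed.

(** * Exponentials of Hermitian matrices *)

Lemma cvg_complex (u v : nat -> R) (a b : R) :
  u @ \oo --> a -> v @ \oo --> b ->
  (fun n => (u n +i* v n) : K) @ \oo --> ((a +i* b) : K).
Proof.
move=> ua vb; apply/cvgrPdist_lt => -[e e'] eps0.
(* A positive element of [R[i]] has zero imaginary part, so the radius is a positive real [e]. *)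
have /andP[/= /eqP e'0 e0] : (e' == 0) && (0 < e) by rewrite ltcE /= in eps0.
rewrite {}e'0 {e' eps0}.
have e20 : 0 < e / 2 by apply: divr_gt0.
move/cvgrPdist_lt/(_ _ e20) : ua => ua; move/cvgrPdist_lt/(_ _ e20) : vb => vb.
near=> n.
have un : `|a - u n| < e / 2 by near: n.
have vn : `|b - v n| < e / 2 by near: n.
rewrite normc_def complexr0 ltcR /=.
have sq (p q : R) : Num.sqrt (p ^+ 2 + q ^+ 2) <= `|p| + `|q|.
  rewrite -(ger0_norm (addr_ge0 (normr_ge0 p) (normr_ge0 q))) -sqrtr_sqr.
  rewrite ler_wsqrtr // sqrrD !real_normK ?num_real // lerD2r lerDl.
  by rewrite mulrn_wge0 // mulr_ge0.
by apply: le_lt_trans (sq _ _) _; rewrite [e]splitr ltrD.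
Unshelve. all: by end_near. Qed.

Lemma exp_i_series (a : R) N :
  series (fun k => k`!%:R^-1 * ('i * a%:C) ^+ k : C) N =
  series (cos_coeff a) N +i* series (sin_coeff a) N.
Proof.
(* Splitting off the parity sends the even powers to the cosine series and the odd ones to the sine
   series. *)
have exp_i k : ('i : C) ^+ k = 'i ^+ odd k * ((-1) ^+ k./2)%:C.
  rewrite -[in LHS](odd_double_half k) exprD -mul2n exprM sqr_i.
  by rewrite rmorphXn rmorphN1.
rewrite /series /=; elim: N => [|N IH]; first by rewrite !big_nil.
rewrite !big_nat_recr //= IH exprMn exp_i -rmorphXn.
rewrite -(rmorph_nat (real_complex R)) -fmorphV /=.
rewrite /cos_coeff /sin_coeff /= -!exprnP.
case oddN: (odd N) => /=.
  (* The sine coefficients carry the exponent [N.-1./2], which agrees with [N./2] for odd [N]. *)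
  have -> : N.-1./2 = N./2.
    by case: N oddN {IH} => //= N /negPf oN; rewrite uphalf_half oN.
  by rewrite expr1; simpc; congr (_ +i* _); ring.
by rewrite expr0; simpc; congr (_ +i* _); ring.
Qed.

Lemma cvg_exp_i (a : R) :
  (series (fun k => k`!%:R^-1 * ('i * a%:C) ^+ k : C) : nat -> K) @ \oo -->
  (cis a : K).
Proof.
rewrite (funext (exp_i_series a)).
refine (@cvg_complex (series (cos_coeff a)) (series (sin_coeff a)) _ _ _ _).
  by rewrite unlock; exact: is_cvg_series_cos_coeff.
by rewrite unlock; exact: is_cvg_series_sin_coeff.
Qed.

Lemma cvg_fin_sum (L : numFieldType) (V : normedModType L) (T : Type)
    (F : set_system T) {FF : Filter F} (I : finType)
    (f : I -> T -> V) (l : I -> V) :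
  (forall i, f i @ F --> l i) -> (fun x => \sum_i f i x) @ F --> \sum_i l i.
Proof. by move=> fl; apply: cvg_big => //; exact: add_continuous. Qed.

Lemma cvg_mx_entries (L : numFieldType) m n
    (M : nat -> 'M[L]_(m, n)) (A : 'M[L]_(m, n)) :
  (forall i j, (fun k => M k i j) @ \oo --> A i j) -> M @ \oo --> A.
Proof.
move=> ML; apply/cvg_ballP => e e0.
have key : \forall k \near \oo, forall i j, ball (A i j) e (M k i j).
  apply: filter_forall => i; apply: filter_forall => j.
  by have /cvg_ballP/(_ e e0) := ML i j.
near=> k; split=> // i j; move: i j; near: k; exact: key.
Unshelve. all: by end_near. Qed.

Lemma exprmx_unitary_diag n (P : 'M[C]_n) (d : 'I_n -> C) k :
  P \is unitarymx ->
  (P^t* *m diag_mx (\row_l d l) *m P : 'M[C]_n) ^+ k =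
  P^t* *m diag_mx (\row_l d l ^+ k) *m P.
Proof.
move=> Pu; have Pu' : P^t* *m P = 1%:M by have /unitarymxP/mulmx1C := Pu.
elim: k => [|k IH].
  have -> : diag_mx (\row_l d l ^+ 0) = 1%:M :> 'M[C]_n.
    by apply/matrixP => i j; rewrite !mxE expr0.
  by rewrite mulmx1 Pu'.
rewrite exprS IH -[LHS]/(_ *m _).
rewrite -!mulmxA (mulmxA P) (unitarymxP Pu) mul1mx; congr (_ *m _).
rewrite !mulmxA mulmx_diag; congr (diag_mx _ *m _).
by apply/rowP => l; rewrite !mxE exprS.
Qed.

(** All terms of the exponential series are diagonal in the same orthonormal basis, so each entry of
    a partial sum is a fixed finite combination of the scalar partial sums handled by
    [cvg_exp_i]. *)
Lemma expmx_herm n (P : 'M[C]_n) (d : 'I_n -> R) : P \is unitarymx ->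
  expmx ('i *: (P^t* *m diag_mx (\row_k (d k)%:C) *m P)) =
  P^t* *m diag_mx (\row_k cis (d k)) *m P.
Proof.
move=> Pu; rewrite /expmx; apply: cvg_lim; first exact: norm_hausdorff.
pose c l k : C := k`!%:R^-1 * ('i * (d l)%:C) ^+ k.
have -> : 'i *: (P^t* *m diag_mx (\row_k (d k)%:C) *m P) =
    P^t* *m diag_mx (\row_k ('i * (d k)%:C)) *m P.
  apply/matrixP => i j; rewrite [LHS]mxE !congr_diagE mulr_sumr.
  by apply: eq_bigr => k _; rewrite !mxE; ring.
have termE k : k`!%:R^-1 *:
      ((P^t* *m diag_mx (\row_k ('i * (d k)%:C)) *m P : 'M[C]_n) ^+ k) =
    P^t* *m diag_mx (\row_l c l k) *m P.
  rewrite exprmx_unitary_diag //.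
  apply/matrixP => i j; rewrite [LHS]mxE !congr_diagE mulr_sumr.
  by apply: eq_bigr => l _; rewrite !mxE /c; ring.
rewrite (funext termE).
apply: cvg_mx_entries => i j.
have serE N :
    series (fun k => P^t* *m diag_mx (\row_l c l k) *m P) N i j =
    \sum_l (P l i)^* * series (c l) N * P l j.
  rewrite /series /= summxE.
  transitivity (\sum_(0 <= k < N) \sum_l (P l i)^* * c l k * P l j).
    apply: eq_bigr => k _; rewrite congr_diagE.
    by apply: eq_bigr => l _; rewrite mxE.
  rewrite exchange_big; apply: eq_bigr => l _.
  by rewrite mulr_sumr mulr_suml.
rewrite (funext serE) congr_diagE.
apply: (@cvg_fin_sum K K^o) => l; apply: (@cvgM K); last exact: cvg_cst.
apply: (@cvgM K); first exact: cvg_cst.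
by rewrite mxE; exact: cvg_exp_i.
Qed.

(** * Eigenvalues of unitary matrices *)

Lemma char_poly_unitary_diag n (P : 'M[C]_n) (d : 'rV[C]_n) :
  P \is unitarymx ->
  char_poly (P^t* *m diag_mx d *m P) = \prod_k ('X - (d 0 k)%:P).
Proof.
move=> Pu; have Pu' : P^t* *m P = 1%:M by have /unitarymxP/mulmx1C := Pu.
have -> : char_poly (P^t* *m diag_mx d *m P) = char_poly (diag_mx d).
  rewrite /char_poly.
  have -> : char_poly_mx (P^t* *m diag_mx d *m P) =
      map_mx polyC (P^t*) *m char_poly_mx (diag_mx d) *m map_mx polyC P.
    rewrite /char_poly_mx !map_mxM mulmxBr mulmxBl; congr (_ - _).
    by rewrite mul_mx_scalar -scalemxAl -map_mxM Pu' map_mx1 scalemx1.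
  rewrite !det_mulmx mulrAC -det_mulmx -map_mxM Pu' map_mx1 det1 mul1r //.
rewrite char_poly_trig; first by apply: eq_bigr => k _; rewrite mxE eqxx mulr1n.
by apply/is_trig_mxP => i j ij; rewrite mxE -val_eqE /= (ltn_eqF ij).
Qed.

(** Unique factorisation of the characteristic polynomial makes [s] a permutation of the diagonal;
    permuting the rows of [P] realises that order, so eigenvectors can be listed in the order of
    prescribed eigenvalues. *)
Lemma unitary_diag_eigenvalues n (A P : 'M[C]_n) (d : 'rV[C]_n)
    (s : 'I_n -> C) :
  P \is unitarymx -> A = P^t* *m diag_mx d *m P -> eigenvalues_of A s ->
  exists2 Q : 'M[C]_n, Q \is unitarymx & A = Q^t* *m diag_mx (\row_k s k) *m Q.
Proof.
move=> Pu AE; rewrite /eigenvalues_of AE char_poly_unitary_diag // => dE.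
have : \prod_(z <- [tuple d 0 k | k < n]) ('X - z%:P) =
       \prod_(z <- [tuple s k | k < n]) ('X - z%:P).
  by rewrite !big_tuple; under eq_bigr do rewrite tnth_mktuple;
     under [RHS]eq_bigr do rewrite tnth_mktuple.
move=> /prod_XsubC_eq; rewrite perm_sym => /tuple_permP[p pE].
have sE k : s k = d 0 (p k).
  have : nth 0 [tuple s k | k < n] k =
      nth 0 [tuple tnth [tuple d 0 k | k < n] (p i) | i < n] k by rewrite pE.
  by rewrite -!tnth_nth !tnth_mktuple.
exists (row_perm p P); first exact: row_perm_unitary.
have -> : \row_k s k = \row_k d 0 (p k) by apply/rowP => k; rewrite !mxE sE.
rewrite (congr_diag_perm p P (d 0)).
by apply: eq_congr_diag => k; rewrite mxE.
Qed.

(** * Norm estimates for vectors, forms and operators *)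

Lemma normc_sum (I : finType) (F : I -> C) :
  normc (\sum_i F i) <= \sum_i normc (F i).
Proof.
elim/big_rec2: _ => [|i p q _ le]; first by rewrite ComplexField.Normc.normc0.
exact: le_trans (le_normcD _ _) (lerD (lexx _) le).
Qed.

Lemma normc_ge0 (z : C) : 0 <= normc z.
Proof. by case: z => a b /=; rewrite sqrtr_ge0. Qed.

Lemma normc_conj (z : C) : normc z^* = normc z.
Proof. by case: z => a b /=; rewrite sqrrN. Qed.

Lemma normc_entry n (v : 'cV[C]_n) i : normc (v i 0) <= norm2 v.
Proof.
rewrite /norm2 -(ger0_norm (normc_ge0 _)) -sqrtr_sqr ler_wsqrtr //.
by rewrite (bigD1 i) //= lerDl sumr_ge0 // => k _; rewrite sqr_ge0.
Qed.

Lemma norm2_sqr n (v : 'cV[C]_n) : norm2 v ^+ 2 = sqnorm v.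
Proof. by rewrite sqr_sqrtr // sqnorm_ge0. Qed.

Lemma norm2_ge0 n (v : 'cV[C]_n) : 0 <= norm2 v.
Proof. exact: sqrtr_ge0. Qed.

Lemma sqnormZ n c (v : 'cV[C]_n) : sqnorm (c *: v) = normc c ^+ 2 * sqnorm v.
Proof.
rewrite /sqnorm mulr_sumr; apply: eq_bigr => i _.
by rewrite mxE ComplexField.Normc.normcM exprMn.
Qed.

Lemma norm2Z n c (v : 'cV[C]_n) : norm2 (c *: v) = normc c * norm2 v.
Proof.
rewrite /norm2 -[X in Num.sqrt X]/(sqnorm _) sqnormZ sqrtrM ?sqr_ge0 //.
by rewrite sqrtr_sqr ger0_norm // normc_ge0.
Qed.

Lemma normc_mulmx_entry m n (A : 'M[C]_(m, n)) (v : 'cV[C]_n) i :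
  normc ((A *m v) i 0) <= (\sum_j normc (A i j)) * norm2 v.
Proof.
rewrite mxE mulr_suml; apply: le_trans (normc_sum _) _; apply: ler_sum => j _.
by rewrite ComplexField.Normc.normcM ler_wpM2l ?normc_ge0 // normc_entry.
Qed.

Lemma sqnorm_mulmx m n (A : 'M[C]_(m, n)) (v : 'cV[C]_n) :
  sqnorm (A *m v) <= (\sum_i (\sum_j normc (A i j)) ^+ 2) * sqnorm v.
Proof.
rewrite mulr_suml; apply: ler_sum => i _.
rewrite -norm2_sqr -exprMn ler_sqr ?nnegrE ?normc_ge0 //.
  exact: normc_mulmx_entry.
by rewrite mulr_ge0 ?norm2_ge0 // sumr_ge0 // => j _; rewrite normc_ge0.
Qed.

Lemma normc_qform n (A : 'M[C]_n) (v : 'cV[C]_n) :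
  normc (qform A v) <= (\sum_i \sum_j normc (A i j)) * sqnorm v.
Proof.
rewrite /qform -mulmxA mxE mulr_suml; apply: le_trans (normc_sum _) _.
apply: ler_sum => i _; rewrite ComplexField.Normc.normcM !mxE normc_conj.
rewrite -norm2_sqr expr2 mulrCA.
apply: ler_pM; rewrite ?normc_ge0 ?normc_entry //.
by have := normc_mulmx_entry A v i; rewrite mxE.
Qed.

Lemma opnorm_eigenvalue n (A : 'M[C]_n) (v : 'cV[C]_n) (lambda : C) :
  v != 0 -> A *m v = lambda *: v -> normc lambda <= opnorm A.
Proof.
move=> v0 Av.
have nv0 : 0 < norm2 v by rewrite sqrtr_gt0 sqnorm_gt0.
pose w := ((norm2 v)^-1)%:C *: v.
have nw : norm2 w = 1.
  rewrite norm2Z /= expr0n addr0 sqrtr_sqr ger0_norm ?invr_ge0 ?norm2_ge0 //.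
  by rewrite mulVf // gt_eqF.
have -> : normc lambda = norm2 (A *m w).
  by rewrite -scalemxAr Av scalerA mulrC -scalerA norm2Z nw mulr1.
apply: ub_le_sup; last by exists w => //=; rewrite nw.
(* [sup] dominates the members of a set only if the set is bounded above; the bound comes from
   [sqnorm_mulmx]. *)
exists (Num.sqrt (\sum_i (\sum_j normc (A i j)) ^+ 2)) => _ [z /= z1 <-].
rewrite /norm2 -[X in Num.sqrt X <= _]/(sqnorm _) ler_wsqrtr //.
apply: le_trans (sqnorm_mulmx _ _) _.
rewrite -[leRHS]mulr1 ler_wpM2l ?sumr_ge0 // => [i _|]; first exact: sqr_ge0.
by rewrite -norm2_sqr -(expr1n _ 2) ler_sqr // ?nnegrE ?norm2_ge0.
Qed.

(** * Angles of a unitary matrix close to the identity *)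

Lemma unitary_diag_eigenvector n (P : 'M[C]_n) (d : 'rV[C]_n) k :
  P \is unitarymx ->
  exists2 v : 'cV[C]_n, v != 0 & (P^t* *m diag_mx d *m P) *m v = d 0 k *: v.
Proof.
move=> Pu; exists (P^t* *m delta_mx k 0).
  apply: unitmx_mulv_neq0; first by rewrite unitarymx_unit ?trmxC_unitary.
  by apply/eqP => /matrixP/(_ k 0)/eqP; rewrite !mxE !eqxx oner_eq0.
rewrite -!mulmxA (mulmxA P) (unitarymxP Pu) mul1mx scalemxAr; congr (_ *m _).
apply/matrixP => i j; rewrite ord1 mul_diag_mx !mxE eqxx andbT.
by case: eqP => [->|]; rewrite ?mulr1 ?mulr0.
Qed.

Lemma normcB_cis (a b : R) :
  normc (cis a - cis b) = Num.sqrt (2 - 2 * cos (a - b)).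
Proof.
rewrite /= cosB; congr Num.sqrt.
have := cos2Dsin2 a; have := cos2Dsin2 b; nra.
Qed.

Lemma expmx_unitary_herm n (P : 'M[C]_n) (d : 'I_n -> R) :
  P \is unitarymx -> P^t* *m diag_mx (\row_k cis (d k)) *m P \is unitarymx.
Proof.
move=> Pu; apply: mul_unitarymx; last exact: Pu.
apply: mul_unitarymx.
  by rewrite trmxC_unitary.
apply/unitarymxP; rewrite tr_diag_mx map_diag_mx mulmx_diag.
rewrite -diag_const_mx; congr diag_mx; apply/rowP => k.
rewrite !mxE /= mulrC mulJc.
by rewrite sqr_normcE /= cos2Dsin2.
Qed.

Lemma pihalf_of_cos_gt0 (a : R) :
  `|a| < pi -> 0 < cos a -> - (pi / 2) < a < pi / 2.
Proof.
move=> api ca; rewrite -ltr_norml ltNge; apply/negP => le.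
have : cos `|a| <= cos (pi / 2).
  have [<-//|ne] := eqVneq (pi / 2) `|a|.
  rewrite ltW // ltr_cos ?in_itv /= ?normr_ge0 ?(ltW api) //; last first.
    by have := @pi_gt0 R; lra.
  by rewrite lt_neqAle ne.
by rewrite cos_pihalf cos_norm leNgt ca.
Qed.

(** If no [z] qualifies, [xget] returns 0, which is Hermitian of norm 0 < pi, so the conclusion
    holds in both cases. *)
Lemma logmxE n (u : 'M[C]_n) : exists2 z : 'M[C]_n,
  z \is hermsymmx /\ opnorm z < pi & logmx u = 'i *: z.
Proof.
rewrite /logmx; case: xgetP => [z _ [zh _ zpi]|_]; first by exists z.
exists 0 => //; split.
  by apply/hermsymmxP; rewrite trmx0 map_mx0.
have norm20 p : norm2 (0 : 'cV[C]_p) = 0.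
  by apply/eqP; rewrite -sqrf_eq0 norm2_sqr sqnorm_eq0.
apply: le_lt_trans (@pi_gt0 R); apply: ge_sup.
  by exists 0, 0; rewrite /= ?mul0mx norm20.
by move=> _ [v _ <-]; rewrite mul0mx norm20.
Qed.

(** The angles are eigenvalues of a matrix of norm below pi, so |theta_k| < pi. Moreover
    cis(theta_k) - 1 is an eigenvalue of u - 1, of modulus sqrt(2 - 2 cos theta_k) < sqrt 2, so cos
    theta_k > 0. Together these confine the angles to the open right half circle. *)
Lemma unitary_phases n (u : 'M[C]_n) (theta : 'I_n -> R) :
  u \is unitarymx -> opnorm (u - 1%:M) < Num.sqrt 2 ->
  eigenvalues_of u (fun k => cis (theta k)) ->
  eigenvalues_of (- 'i *: logmx u) (fun k => (theta k)%:C) ->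
  (forall k, - (pi / 2) < theta k < pi / 2) /\
  exists2 Q : 'M[C]_n, Q \is unitarymx &
    u = Q^t* *m diag_mx (\row_k cis (theta k)) *m Q.
Proof.
move=> uU u1 eu el.
have [Q QU uE] : exists2 Q : 'M[C]_n, Q \is unitarymx &
    u = Q^t* *m diag_mx (\row_k cis (theta k)) *m Q.
  have /orthomx_spectralP : u \is normalmx.
    by apply/normalmxP; have /unitarymxP H := uU; rewrite H (mulmx1C H).
  rewrite invmx_unitary ?spectral_unitarymx // => sE.
  exact: (unitary_diag_eigenvalues (spectral_unitarymx u) sE eu).
split; last by exists Q.
have [z [zh zpi] lE] := logmxE u.
have zE : - 'i *: logmx u = z.
  by rewrite lE scalerA mulNr -expr2 sqr_i opprK scale1r.
have [P [d [PU PE]]] := herm_spectral zh.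
rewrite zE in el; have [S SU SE] := unitary_diag_eigenvalues PU PE el.
move=> k; apply: pihalf_of_cos_gt0.
  have [v v0] := unitary_diag_eigenvector (\row_k (theta k)%:C) k SU.
  rewrite -SE mxE => /(opnorm_eigenvalue v0) /le_lt_trans/(_ zpi) /=.
  by rewrite expr0n addr0 sqrtr_sqr.
have [v v0] := unitary_diag_eigenvector (\row_k cis (theta k)) k QU.
rewrite -uE mxE => uv.
have : (u - 1%:M) *m v = (cis (theta k) - cis 0) *: v.
  by rewrite mulmxBl mul1mx uv scalerBl cis0 scale1r.
move=> /(opnorm_eigenvalue v0)/le_lt_trans/(_ u1).
rewrite normcB_cis subr0 ltr_sqrt //; lra.
Qed.

(** Here cis(theta) = cos(theta) (1 + i tan(theta)) with a positive cosine, and [tan] is increasing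
    on the interval, so the phases of such a unitary matrix are its eigenvalue angles. *)
Lemma unitary_tan_phases n (Q : 'M[C]_n) (theta : 'I_n -> R) :
  Q \is unitarymx -> (forall k, - (pi / 2) < theta k < pi / 2) ->
  (forall j k : 'I_n, (j < k)%N -> theta k < theta j) ->
  tan_phases (Q^t* *m diag_mx (\row_k cis (theta k)) *m Q)
    (fun k => tan (theta k)).
Proof.
move=> QU thI dec.
apply: (@tan_phases_scaled _ _ Q (fun k => cos (theta k))).
- exact: unitarymx_unit.
- by move=> k; apply: cos_gt0_pihalf.
- apply: eq_congr_diag => k; rewrite !mxE.
  have c0 : cos (theta k) != 0 by rewrite gt_eqF // cos_gt0_pihalf.
  by simpc; rewrite /tan mulrC divfK.
- move=> j k; rewrite leq_eqVlt => /orP[/eqP/val_inj -> //|jk].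
  by rewrite ltW // ltr_tan ?in_itv ?thI //= dec.
Qed.

(** * Perturbation and compression *)

Lemma normc_Re (z : C) : `|complex.Re z| <= normc z.
Proof.
by case: z => a b /=; rewrite -sqrtr_sqr ler_wsqrtr // lerDl sqr_ge0.
Qed.

Lemma normc_Im (z : C) : `|complex.Im z| <= normc z.
Proof.
by case: z => a b /=; rewrite -sqrtr_sqr ler_wsqrtr // lerDr sqr_ge0.
Qed.

Lemma tan_phases_coercive n (A : 'M[C]_n) a : tan_phases A a ->
  exists2 kappa : R, 0 < kappa &
    forall v, kappa * sqnorm v <= complex.Re (qform A v).
Proof.
move=> [[Z Zu ->] _].
pose c : R := \sum_i (\sum_j normc (invmx Z i j)) ^+ 2.
have c0 : 0 <= c by apply: sumr_ge0 => i _; apply: sqr_ge0.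
have c1 : 0 < c + 1 by rewrite ltr_wpDl.
(* Since |v|^2 <= c |Zv|^2, any constant up to 1/c would do; adding 1 keeps the inverse positive
   even when c = 0, as for empty matrices. *)
exists (c + 1)^-1; first by rewrite invr_gt0.
move=> v; rewrite Re_qform_phases mulrC ler_pdivrMr //.
have := sqnorm_mulmx (invmx Z) (Z *m v); rewrite mulKmx // -/c => le.
apply: le_trans le _; rewrite [leRHS]mulrC ler_wpM2r ?sqnorm_ge0 //.
by rewrite lerDl.
Qed.

Lemma tan_phases_close n (A : 'M[C]_n) a (eta : R) :
  tan_phases A a -> 0 < eta ->
  exists2 eps, 0 < eps & forall (B : 'M[C]_n) b, tan_phases B b ->
    (forall v, normc (qform B v - qform A v) <= eps * sqnorm v) ->
    forall j, `|atan (b j) - atan (a j)| <= eta.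
Proof.
move=> hA eta0; have [kappa k0 hk] := tan_phases_coercive hA.
(* Stated with a filter on small positive [eps], the finitely many conditions indexed by [j] combine
   into a single [eps]. *)
suff : \forall eps \near (0 : R)^'+, forall j (B : 'M[C]_n) b, tan_phases B b ->
    (forall v, normc (qform B v - qform A v) <= eps * sqnorm v) ->
    `|atan (b j) - atan (a j)| <= eta.
  move=> H; have [eps [eps0 He]] := filter_ex (filterI (nbhs_right_gt 0) H).
  by exists eps => // B b hB hq j; apply: He hB hq.
apply: filter_forall => j.
have [delta d0 hd] : exists2 delta : R, 0 < delta &
    forall z, `|z - a j| <= delta -> `|atan z - atan (a j)| <= eta.
  have /cvgrPdist_le/(_ _ eta0) := @continuous_atan R (a j).
  move=> /nbhs_ballP[d /= d0 hd]; exists (d / 2); first exact: divr_gt0.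
  move=> z hz; rewrite distrC; apply: hd; rewrite /ball /= distrC.
  by apply: le_lt_trans hz _; lra.
have p0 : 0 < 1 + `|a j| + delta by rewrite ltr_wpDl // addr_ge0.
have q0 : 0 < delta * kappa / (1 + `|a j| + delta).
  by rewrite divr_gt0 // mulr_gt0.
near=> eps => B b hB hq; apply: hd.
apply: (tan_phases_perturbation hA hB (ltW d0) (eps := eps)
  (kappa := kappa)) => //.
- by move=> v; apply: le_trans (normc_Re _) (hq v).
- by move=> v; apply: le_trans (normc_Im _) (hq v).
- rewrite -ltr_pdivlMr //; near: eps; exact: nbhs_right_lt.
Unshelve. all: by end_near. Qed.

(** For unitary [P] and x = P^* diag(d) P this is e^{isx}, in diagonalised form. *)
Definition unitary_flow n (P : 'M[C]_n) (d : 'I_n -> R) (s : R) : 'M[C]_n :=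
  P^t* *m diag_mx (\row_k cis (s * d k)) *m P.

Lemma unitary_flowD n (P : 'M[C]_n) d s t : P \is unitarymx ->
  unitary_flow P d (s + t) = unitary_flow P d s *m unitary_flow P d t.
Proof.
move=> PU; rewrite /unitary_flow -!mulmxA (mulmxA P (P^t*)).
rewrite (unitarymxP PU) mul1mx.
congr (_ *m _); rewrite mulmxA mulmx_diag; congr (diag_mx _ *m _).
by apply/rowP => k; rewrite !mxE mulrDl cisD.
Qed.

Lemma unitary_flowN n (P : 'M[C]_n) d s :
  unitary_flow P d (- s) = (unitary_flow P d s)^t*.
Proof.
rewrite /unitary_flow !trmx_mul !map_mxM trmxCK mulmxA.
rewrite tr_diag_mx map_diag_mx; congr (_ *m _); congr (_ *m _).
apply: congr1; apply/rowP => k; rewrite !mxE mulNr.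
by rewrite /cis /= cosN sinN.
Qed.

Lemma unitary_flow_continuous n (P Y : 'M[C]_n) d t (eps : R) : 0 < eps ->
  exists2 delta, 0 < delta & forall t', `|t' - t| < delta -> forall v,
    normc (qform (unitary_flow P d t' *m Y) v -
           qform (unitary_flow P d t *m Y) v) <= eps * sqnorm v.
Proof.
move=> eps0.
(* [F t'] dominates the sum of the moduli of the entries of the difference, which is the constant of
   [normc_qform]; it is continuous and vanishes at [t]. *)
pose c i j k := normc ((P^t*) i k) * normc ((P *m Y) k j).
pose F t' := \sum_i \sum_j \sum_k
  c i j k * Num.sqrt (2 - 2 * cos (t' * d k - t * d k)).
have F0 : F t = 0.
  rewrite /F !big1 // => i _; rewrite big1 // => j _; rewrite big1 // => k _.
  by rewrite subrr cos0 mulr1 subrr sqrtr0 mulr0.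
have Fc : F @ t --> (0 : R).
  rewrite -F0; apply: (@cvg_fin_sum R R^o) => i.
  apply: (@cvg_fin_sum R R^o) => j; apply: (@cvg_fin_sum R R^o) => k.
  apply: cvgM; first exact: cvg_cst.
  apply: (@continuous_comp R R R
      (fun s => 2 - 2 * cos (s * d k - t * d k)) Num.sqrt);
    last exact: sqrt_continuous.
  apply: cvgB; first exact: cvg_cst.
  apply: cvgM; first exact: cvg_cst.
  apply: (@continuous_comp R R R (fun s => s * d k - t * d k) cos);
    last exact: continuous_cos.
  apply: cvgB; last exact: cvg_cst.
  by apply: cvgM; [exact: cvg_id | exact: cvg_cst].
have /cvgrPdist_le/(_ _ eps0)/nbhs_ballP[delta /= d0 hd] := Fc.
exists delta => // t' ht v.
rewrite -qformB; apply: le_trans (normc_qform _ _) _.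
rewrite ler_wpM2r ?sqnorm_ge0 //.
have {hd} hF : F t' <= eps.
  have := hd t'; rewrite /ball /= distrC => /(_ ht).
  by rewrite sub0r normrN; apply: le_trans (ler_norm _).
apply: le_trans hF; rewrite /F; apply: ler_sum => i _; apply: ler_sum => j _.
have -> : (unitary_flow P d t' *m Y - unitary_flow P d t *m Y) i j =
   \sum_k (P^t*) i k * (cis (t' * d k) - cis (t * d k)) * (P *m Y) k j.
  rewrite /unitary_flow -!mulmxA -mulmxBr -mulmxBl mxE; apply: eq_bigr => k _.
  rewrite -mulrA; congr (_ * _).
  have -> : diag_mx (\row_k cis (t' * d k)) - diag_mx (\row_k cis (t * d k)) =
     diag_mx (\row_k (cis (t' * d k) - cis (t * d k))) :> 'M[C]_n.
    by rewrite -raddfB; congr diag_mx; apply/rowP => l; rewrite !mxE.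
  by rewrite mul_diag_mx !mxE.
apply: le_trans (normc_sum _) _; apply: ler_sum => k _.
by rewrite !ComplexField.Normc.normcM normcB_cis mulrAC.
Qed.

(** * Compression to the top eigenvectors *)

Lemma sqnorm_isometry m n (X : 'M[C]_(n, m)) v :
  X^t* *m X = 1%:M -> sqnorm (X *m v) = sqnorm v.
Proof.
have sqE p (w : 'cV[C]_p) : qform 1%:M w = (sqnorm w)%:C.
  rewrite /qform mulmx1 mxE rmorph_sum; apply: eq_bigr => k _.
  by rewrite !mxE mulJc.
move=> XX; apply: (@complexI R).
by rewrite -!sqE -qform_comp mulmx1 XX.
Qed.

Lemma unitary_top_compression n m (lemn : (m <= n)%N) (Q U : 'M[C]_n)
    (theta : 'I_n -> R)
    (D := diag_mx (\row_(j < m) cis (theta (widen_ord lemn j)))) :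
  Q \is unitarymx -> U = Q^t* *m diag_mx (\row_k cis (theta k)) *m Q ->
  exists2 X : 'M[C]_(n, m), X^t* *m X = 1%:M & U *m X = X *m D.
Proof.
move=> QU UE.
(* The columns of [W] are the first [m] basis vectors, so those of the witness are the eigenvectors
   of the [m] largest angles once [theta] is decreasing. *)
pose W : 'M[C]_(n, m) := \matrix_(i, j) (i == widen_ord lemn j)%:R.
exists (Q^t* *m W).
  rewrite trmx_mul map_mxM trmxCK mulmxA -[_ *m Q *m _]mulmxA.
  rewrite (unitarymxP QU) mulmx1; apply/matrixP => i j.
  rewrite mxE (bigD1 (widen_ord lemn j)) //= big1 => [|k kj].
    by rewrite !mxE eqxx mulr1 addr0 conjC_nat eq_sym -!val_eqE.
  by rewrite !mxE (negPf kj) mulr0.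
rewrite UE -!mulmxA (mulmxA Q) (unitarymxP QU) mul1mx; congr (_ *m _).
apply/matrixP => i j; rewrite mul_diag_mx mul_mx_diag !mxE.
by case: eqP => [->|]; rewrite ?mulr1 ?mul1r // mulr0 mul0r.
Qed.

(** This turns an equality of phases modulo pi into an inequality, given a rough lower bound. *)
Lemma sin_eq0_ge0 (x : R) : sin x = 0 -> - pi < x -> 0 <= x.
Proof.
move=> sx px; rewrite leNgt; apply/negP => x0.
have : 0 < sin (- x) by apply: sin_gt0_pi; lra.
by rewrite sinN sx oppr0 ltxx.
Qed.

(** [F] stands for e^{isx}, and [theta1], [theta2] for the angles at t + s and t - s. Let p1, p2 be
    the phase sums of the two compressions and f that of [D]. Interlacing bounds p1 and p2 above by
    the top angle sums; the determinants give sin(p1 + p2 - 2f) = 0; closeness gives p1 + p2 - 2f >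
    -pi. Hence p1 + p2 >= 2f. *)
Lemma top_phases_midpoint n m (lemn : (m <= n)%N) (Q U : 'M[C]_n)
    (theta : 'I_n -> R) :
  Q \is unitarymx -> U = Q^t* *m diag_mx (\row_k cis (theta k)) *m Q ->
  (forall k, - (pi / 2) < theta k < pi / 2) ->
  (forall j k : 'I_n, (j < k)%N -> theta k < theta j) ->
  exists2 eps : R, 0 < eps &
  forall (F : 'M[C]_n) (theta1 theta2 : 'I_n -> R),
    (forall k, - (pi / 2) < theta1 k < pi / 2) ->
    (forall k, - (pi / 2) < theta2 k < pi / 2) ->
    tan_phases (F *m U) (fun k => tan (theta1 k)) ->
    tan_phases (F^t* *m U) (fun k => tan (theta2 k)) ->
    (forall v, normc (qform (F *m U) v - qform U v) <= eps * sqnorm v) ->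
    (forall v, normc (qform (F^t* *m U) v - qform U v) <= eps * sqnorm v) ->
    2 * \sum_(j < m) theta (widen_ord lemn j) <=
      \sum_(j < m) theta1 (widen_ord lemn j) +
      \sum_(j < m) theta2 (widen_ord lemn j).
Proof.
move=> QU UE thI dec.
have [X XX UX] := unitary_top_compression lemn QU UE.
set D := diag_mx _ in UX.
have hD : tan_phases D (fun j => tan (theta (widen_ord lemn j))).
  have := @unitary_tan_phases m 1%:M (fun j => theta (widen_ord lemn j)).
  rewrite trmx1 map_mx1 mul1mx mulmx1; apply.
  - by apply/unitarymxP; rewrite trmx1 map_mx1 mulmx1.
  - by move=> k; apply: thI.
  - by move=> j k jk; apply: dec.
have XUX : X^t* *m U *m X = D by rewrite -mulmxA UX mulmxA XX mul1mx.
(* Then [m] deviations of size [eta] add up to strictly less than pi / 2, so the two compressions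
   together lose less than pi. *)
pose eta : R := pi / (2 * m.+1%:R).
have eta0 : 0 < eta by rewrite divr_gt0 ?pi_gt0 // mulr_gt0 ?ltr0n.
have [eps eps0 heps] := tan_phases_close hD eta0.
exists eps => // F th1 th2 th1I th2I h1 h2 c1 c2.
have step (B : 'M[C]_n) th : (forall k, - (pi / 2) < th k < pi / 2) ->
    tan_phases (B *m U) (fun k => tan (th k)) ->
    (forall v, normc (qform (B *m U) v - qform U v) <= eps * sqnorm v) ->
    exists g : 'I_m -> R, [/\ tan_phases (X^t* *m (B *m U) *m X) g,
      \sum_j atan (g j) <= \sum_(j < m) th (widen_ord lemn j) &
      \sum_(j < m) theta (widen_ord lemn j) - pi / 2 < \sum_j atan (g j)].
  move=> thBI hB cB.
  have [g hg] : exists g, tan_phases (X^t* *m (B *m U) *m X) g.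
    apply: tan_phases_exists => v v0; rewrite qform_comp.
    apply: (tan_phases_Re_gt0 hB).
    by rewrite -sqnorm_gt0 sqnorm_isometry // sqnorm_gt0.
  exists g; split=> //.
    apply: ler_sum => j _.
    have := tan_phases_compression lemn j hB hg.
    by move=> /le_atan; rewrite tanK // in_itv /= thBI.
  have hj j : theta (widen_ord lemn j) - eta <= atan (g j).
    have := heps _ _ hg; rewrite -XUX => /(_ _ j) H.
    have := H _; rewrite tanK ?in_itv /= ?thI // => {}H.
    have : `|atan (g j) - theta (widen_ord lemn j)| <= eta.
      by apply: H => v; rewrite !qform_comp -[sqnorm v](sqnorm_isometry _ XX).
    by rewrite ler_norml; lra.
  apply: lt_le_trans (ler_sum _ (fun j _ => hj j)).
  rewrite sumrB ltrD2l ltrN2 sumr_const card_ord.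
  have -> : eta *+ m = pi / 2 * (m%:R / m.+1%:R).
    by rewrite /eta -[_ *+ m]mulr_natr invfM; ring.
  rewrite gtr_pMr ?divr_gt0 ?pi_gt0 //.
  by rewrite ltr_pdivrMr ?ltr0n // mul1r ltr_nat.
have [g1 [hg1 up1 lo1]] := step F th1 th1I h1 c1.
have [g2 [hg2 up2 lo2]] := step (F^t*) th2 th2I h2 c2.
set f := \sum_(j < m) theta _ in lo1 lo2 *.
have detD : \det D = cis f.
  by rewrite det_diag /f cis_sum; apply: eq_bigr => j _; rewrite mxE.
have [r1 r10 d1] := tan_phases_det hg1.
have [r2 r20 d2] := tan_phases_det hg2.
(* As U X = X D, the two compressions factor as N D and N^* D, with determinants that differ from
   cis f by conjugate factors. *)
set N := X^t* *m F *m X.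
have e1 : \det (X^t* *m (F *m U) *m X) = \det N * cis f.
  by rewrite -detD -det_mulmx /N -!mulmxA UX.
have e2 : \det (X^t* *m (F^t* *m U) *m X) = (\det N)^* * cis f.
  transitivity (\det (N^t*) * cis f); last by rewrite det_map_mx det_tr.
  have -> : N^t* = X^t* *m F^t* *m X.
    by rewrite /N !trmx_mul !map_mxM trmxCK mulmxA.
  by rewrite -detD -det_mulmx -!mulmxA UX.
set p1 := \sum_j atan (g1 j) in d1 up1 lo1 *.
set p2 := \sum_j atan (g2 j) in d2 up2 lo2 *.
suff : 0 <= p1 + p2 - 2 * f by lra.
apply: sin_eq0_ge0; last by lra.
have cisNK (z : R) : cis z * cis (- z) = 1 :> C by rewrite -cisD subrr cis0.
(* Multiplying both determinants and cancelling cis(2f) leaves |det N|^2, which is real, so the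
   imaginary part yields the vanishing sine. *)
have : (r1 * r2)%:C * cis (p1 + p2 - 2 * f) = (normc (\det N) ^+ 2)%:C.
  have -> : p1 + p2 - 2 * f = p1 + p2 + (- f + - f) by ring.
  rewrite !cisD rmorphM /=.
  transitivity ((r1%:C * cis p1) * (r2%:C * cis p2) * (cis (- f) * cis (- f))).
    by ring.
  rewrite -d1 -d2 e1 e2 -mulJc.
  transitivity ((\det N)^* * \det N *
      ((cis f * cis (- f)) * (cis f * cis (- f)))).
    by ring.
  by rewrite !cisNK !mulr1.
move=> /(congr1 (@complex.Im R)); rewrite ImM_real /= => /eqP.
by rewrite mulf_eq0 (gt_eqF (mulr_gt0 r10 r20)) /= => /eqP.
Qed.

End TanPhases.

Theorem theorem3p3 (R : realType) (n : nat) (x y : 'M[R[i]]_n) (t0 : R)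
    (theta : R -> 'I_n -> R) (u : R -> 'M[R[i]]_n)
    (u_def : forall t : R, u t = expmx (('i * t%:C) *: x) *m expmx ('i *: y))
    (x_herm : x \is hermsymmx) (y_herm : y \is hermsymmx) (t0_gt0 : 0 < t0)
    (u_near1 : forall t : R, 0 <= t <= t0 -> opnorm (u t - 1%:M) < Num.sqrt 2)
    (u_eig : forall t : R, 0 <= t <= t0 ->
      eigenvalues_of (u t) (fun k => cis (theta t k)) /\
      injective (fun k => cis (theta t k)))
    (theta_eig : forall t : R, 0 <= t <= t0 ->
      eigenvalues_of (- 'i *: logmx (u t)) (fun k => (theta t k)%:C))
    (theta_decr : forall t : R, 0 <= t <= t0 ->
      forall j k : 'I_n, (j < k)%N -> theta t k < theta t j)
    (m : nat) (m_bounds : (1 <= m <= n)%N) :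
  convex_function (`[0, t0] : set R^o)
    (fun t : R^o => \sum_(i < n | (i < m)%N) theta t i : R^o).
Proof.
have lemn : (m <= n)%N by case/andP: m_bounds.
have [P [d [PU xE]]] := herm_spectral x_herm.
have [S [e [SU yE]]] := herm_spectral y_herm.
pose Y := expmx ('i *: y).
have YU : Y \is unitarymx.
  by have := expmx_herm e SU; rewrite -yE /Y => ->; apply: expmx_unitary_herm.
have uE t : u t = unitary_flow P d t *m Y.
  rewrite u_def; congr (_ *m _); rewrite /unitary_flow.
  have := expmx_herm (fun k => t * d k) PU => <-; congr expmx.
  apply/matrixP => i j; rewrite [LHS]mxE xE [RHS]mxE !congr_diagE !mulr_sumr.
  by apply: eq_bigr => k _; rewrite !mxE rmorphM /=; ring.
have uU t : u t \is unitarymx.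
  rewrite uE; apply: mul_unitarymx; last exact: YU.
  exact: expmx_unitary_herm.
have phases t : 0 <= t <= t0 -> (forall k, - (pi / 2) < theta t k < pi / 2) /\
    exists2 Q : 'M[R[i]]_n, Q \is unitarymx &
      u t = (Q^t*)%sesqui *m diag_mx (\row_k cis (theta t k)) *m Q.
  move=> tI; apply: (unitary_phases (uU t) (u_near1 t tI)).
    by have [] := u_eig t tI.
  exact: theta_eig.
have tanp t : 0 <= t <= t0 -> tan_phases (u t) (fun k => tan (theta t k)).
  move=> tI; have [thI [Q QU ->]] := phases t tI.
  by apply: unitary_tan_phases => //; apply: theta_decr.
have tanthK t k : 0 <= t <= t0 -> atan (tan (theta t k)) = theta t k.
  by move=> tI; have [thI _] := phases t tI; rewrite tanK // in_itv /= thI.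
have -> : (fun t : R^o => \sum_(i < n | (i < m)%N) theta t i : R^o) =
    (fun t => \sum_(j < m) theta t (widen_ord lemn j)).
  by apply/funext => t; rewrite (big_ord_narrow lemn).
apply: convex_function_midpoint.
  move=> t tI eta eta0.
  (* An error of at most [eta / m.+1%:R] in each of the [m] angles stays below [eta] in the sum. *)
  have eta'0 : 0 < eta / m.+1%:R by rewrite divr_gt0.
  have [eps eps0 close] := tan_phases_close (tanp t tI) eta'0.
  have [delta d0 cont] := unitary_flow_continuous P Y d t eps0.
  exists delta => // t' t'I tt'; rewrite -sumrB.
  apply: le_trans (ler_norm_sum _ _ _) _.
  apply: (@le_trans _ _ (\sum_(j < m) eta / m.+1%:R)).
    apply: ler_sum => j _.
    have := close _ _ (tanp t' t'I) _ (widen_ord lemn j).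
    by rewrite !tanthK // !uE; apply => v; apply: cont.
  have -> : \sum_(j < m) eta / m.+1%:R = eta * (m%:R / m.+1%:R).
    by rewrite sumr_const card_ord -[_ *+ m]mulr_natr; ring.
  apply: ler_piMr; first exact: ltW.
  by rewrite ler_pdivrMr ?ltr0n // mul1r ler_nat.
move=> t /andP[t_gt0 t_lt].
have tI : 0 <= t <= t0 by rewrite !ltW.
have [thI [Q QU uQ]] := phases t tI.
have [eps eps0 mid] := top_phases_midpoint lemn QU uQ thI (theta_decr t tI).
have [delta d0 cont] := unitary_flow_continuous P Y d t eps0.
(* [delta] makes both forms close to that of [u t]; the bounds [t] and [t0 - t] keep t - s and t + s
   in the interval where the hypotheses hold. *)
exists (Num.min delta (Num.min t (t0 - t))).
  by rewrite !lt_min d0 t_gt0 subr_gt0.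
move=> s /andP[s0]; rewrite !lt_min => /and3P[sd st st0].
have tmI : 0 <= t - s <= t0 by lra.
have tpI : 0 <= t + s <= t0 by lra.
(* By the group law both neighbours come from [u t] by left multiplication, with e^{isx} and with
   its adjoint, as [mid] requires. *)
have up : u (t + s) = unitary_flow P d s *m u t.
  by rewrite !uE (addrC t) (unitary_flowD d s t PU) mulmxA.
have um : u (t - s) = ((unitary_flow P d s)^t*)%sesqui *m u t.
  by rewrite !uE (addrC t) (unitary_flowD d (- s) t PU) unitary_flowN -mulmxA.
rewrite /= [X in _ <= X]addrC; apply: (mid (unitary_flow P d s)).
- by have [] := phases _ tpI.
- by have [] := phases _ tmI.
- by rewrite -up; apply: tanp.
- by rewrite -um; apply: tanp.
- move=> v; rewrite -up !uE; apply: cont.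
  by rewrite addrC addKr gtr0_norm.
- move=> v; rewrite -um !uE; apply: cont.
  by rewrite addrC addKr normrN gtr0_norm.
Qed.
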